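(* Let $\phi$ be an essentially smooth transformation whose conjugate $\psi=\phi^\star$ is thrice continuously differentiable with $\psi''>0$. Write $R_{\psi'}(t)=\psi'''(t)/\psi''(t)$, and let $\rho_\gamma$ be the response function generated by $\phi$ for $\gamma\in(0,1)$. The following statements are equivalent: (i) For all $\gamma\in(0,1)$, $\rho_\gamma$ is strongly S-shaped. (ii) $R_{\psi'}$ is decreasing (on $\mathbb{R}$). Moreover, under these conditions, $R_{\phi'}=\phi'''/\phi''$ is increasing (on $(0,+\infty)$).
   Context: Increasing and decreasing are understood in the weak sense. A transformation is a convex, lower semicontinuous $\phi:\mathbb{R}_+\to[0,+\infty]$ with $\phi(1)=0$ which (standing assumption) is superlinear at infinity ($\phi(t)/t\to+\infty$ as $t\to+\infty$), strictly convex on $\operatorname{int}(\operatorname{dom}\phi)$, and satisfies $1\in\operatorname{int}(\operatorname{dom}\phi)$. It is essentially smooth if it is finite and differentiable on $(0,+\infty)$ and $\lim_{t\to0}\phi'(t)=-\infty$. Conjugate: $\psi(t)=\phi^\star(t)=\sup_{u\ge0}tu-\phi(u)$, $t\in\mathbb{R}$. (The assumption on $\psi$ is equivalent to $\phi$ being thrice continuously differentiable with $\phi''>0$ on $(0,+\infty)$.) For $\gamma\in(0,1)$, the response function is $\rho_\gamma:(0,+\infty)\to(0,1)$, $\rho_\gamma(w)=\gamma\psi'(w-\ell_\gamma(w))$, where $\ell_\gamma(w)\in\mathbb{R}$ is the unique solution of $\gamma\psi'(w-\ell_\gamma(w))+(1-\gamma)\psi'(-\ell_\gamma(w))=1$.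 Under the assumptions above $\rho_\gamma$ is twice continuously differentiable with $\rho_\gamma'>0$. $\rho_\gamma$ is strongly S-shaped if $R_{\rho_\gamma}=\rho_\gamma''/\rho_\gamma'$ is decreasing on $(0,+\infty)$. *)

(* Defs.v *)
From Stdlib Require Import Reals Lra.
From Coquelicot Require Import Coquelicot.

Open Scope R_scope.

Definition decreasing_on (D : R -> Prop) (f : R -> R) : Prop :=
  forall x y : R, D x -> D y -> x <= y -> f y <= f x.

Definition increasing_on (D : R -> Prop) (f : R -> R) : Prop :=
  forall x y : R, D x -> D y -> x <= y -> f x <= f y.

(* A function R_+ -> [0, +oo] is represented by phi : R -> Rbar; its values on
   the negative half-line are junk and are never used. *)
Definition dom (phi : R -> Rbar) (u : R) : Prop :=
  0 <= u /\ Rbar_lt (phi u) p_infty.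

(* Interior relative to R, so 0 never belongs to it. *)
Definition int_dom (phi : R -> Rbar) (u : R) : Prop :=
  locally u (dom phi).

Record transformation (phi : R -> Rbar) : Prop := {
  transf_ge0 : forall u : R, 0 <= u -> Rbar_le 0 (phi u);
  transf_convex : forall x y a : R, 0 <= x -> 0 <= y -> 0 < a < 1 ->
    Rbar_le (phi (a * x + (1 - a) * y))
            (Rbar_plus (Rbar_mult a (phi x)) (Rbar_mult (1 - a) (phi y)));
  transf_lsc : forall x m : R, 0 <= x -> Rbar_lt m (phi x) ->
    within (fun u : R => 0 <= u) (locally x) (fun u => Rbar_lt m (phi u));
  transf_at1 : phi 1 = Finite 0;
  transf_superlinear : forall m : R,
    Rbar_locally p_infty (fun t : R => Rbar_lt m (Rbar_div (phi t) t));
  transf_strictly_convex : forall x y a : R,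
    int_dom phi x -> int_dom phi y -> x <> y -> 0 < a < 1 ->
    Rbar_lt (phi (a * x + (1 - a) * y))
            (Rbar_plus (Rbar_mult a (phi x)) (Rbar_mult (1 - a) (phi y)));
  transf_int1 : int_dom phi 1
}.

(* Real-valued version, meaningful where phi is finite. *)
Definition rval (phi : R -> Rbar) (u : R) : R := real (phi u).

Record essentially_smooth (phi : R -> Rbar) : Prop := {
  esm_finite : forall t : R, 0 < t -> is_finite (phi t);
  esm_derivable : forall t : R, 0 < t -> ex_derive (rval phi) t;
  esm_at0 : filterlim (Derive (rval phi)) (at_right 0) (Rbar_locally m_infty)
}.

Definition conjugate (phi : R -> Rbar) (t : R) : Rbar :=
  Rbar_lub (fun y : Rbar =>
    exists u : R, 0 <= u /\ y = Rbar_minus (Finite (t * u)) (phi u)).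

(* The conjugate of a transformation is finite on R, by superlinearity. *)
Definition rconjugate (phi : R -> Rbar) (t : R) : R := real (conjugate phi t).

(* [ex_derive_n f k] alone does not assert the existence of the derivatives of
   order below [k]. *)
Definition thrice_cont_diff (f : R -> R) : Prop :=
  forall t : R,
    (forall k : nat, (k <= 3)%nat -> ex_derive_n f k t)
    /\ continuous (Derive_n f 3) t.

(* R_f = f'' / f' *)
Definition Rratio (f : R -> R) (t : R) : R := Derive_n f 2 t / Derive f t.

(* [iota] is definite description: for phi essentially smooth with
   differentiable conjugate, the solution exists and is unique. *)
Definition ell (phi : R -> Rbar) (gamma w : R) : R :=
  iota (fun l : R =>
    gamma * Derive (rconjugate phi) (w - l)
      + (1 - gamma) * Derive (rconjugate phi) (- l) = 1).

(* Only the values at w > 0 are meaningful. *)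
Definition response (phi : R -> Rbar) (gamma w : R) : R :=
  gamma * Derive (rconjugate phi) (w - ell phi gamma w).

Definition strongly_S_shaped (rho : R -> R) : Prop :=
  decreasing_on (fun w : R => 0 < w) (Rratio rho).

(* Main.v *)
(* Put g = psi' and f = phi'. By Fenchel-Young, g (f u) = u for u > 0, which gives
   R_phi' = - (R_g / g') o f. Writing a = w - ell and b = - ell, the response
   rho = gamma g(a) inverts r |-> f(r/gamma) - f((1-r)/(1-gamma)), and
     R_rho = p^2 R_g(a) - (1-p)^2 R_g(b),  p = da/dw,
     p' = - p (1-p) (p R_g(a) + (1-p) R_g(b)).
   As w grows, a increases and b decreases, so when R_g is decreasing only the
   variation of the weights p^2 and (1-p)^2 could make R_rho grow; it contributes
   - 2 p (1-p) (p R_g(a) + (1-p) R_g(b))^2 <= 0. Conversely, as gamma tends to 0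
   (resp. 1), R_rho(w) tends to R_g(f 1 + w) (resp. - R_g(f 1 - w)), which gives
   the monotonicity of R_g on either side of f 1. *)
Require Import Defs.
From Stdlib Require Import Reals Lra Lia.
From Coquelicot Require Import Coquelicot.

(* The eta-expanded form in which [auto_derive] leaves its results. *)
Lemma Derive_eta (f : R -> R) (x l : R) : is_derive f x l -> Derive (fun y : R => f y) x = l.
Proof. apply is_derive_unique. Qed.

(** * Monotonicity from local bounds on increments *)

(** Supremum argument: [E] collects the points [t] up to which [f] has grown by at most
    [eps * (t - x)]. At [m], the supremum of [E], the hypothesis carries membership from some [s] in
    [E] close to [m] to a point beyond [m], unless [m = y]. *)
Lemma straddle_decreasing (f : R -> R) (x y : R) :
  x <= y ->
  (forall t eps : R, x <= t <= y -> 0 < eps ->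
    exists d : R, 0 < d /\
      forall s r : R, x <= s <= t -> t <= r <= y -> t - d < s -> r < t + d ->
        f r - f s <= eps * (r - s)) ->
  f y <= f x.
Proof.
intros Hxy Hloc.
apply le_epsilon. intros eps0 Heps0.
(* The [+ 1] keeps the denominator positive when [x = y]. *)
set (eps := eps0 / (y - x + 1)).
assert (Heps : 0 < eps) by (apply Rdiv_lt_0_compat; lra).
assert (Hsmall : eps * (y - x) <= eps0).
{ replace eps0 with (eps * (y - x + 1)) by (unfold eps; field; lra).
  apply Rmult_le_compat_l; lra. }
set (E := fun t => x <= t <= y /\ f t - f x <= eps * (t - x)).
assert (Ex : E x) by (split; lra).
destruct (completeness E) as [m [Hub Hlub]].
{ exists y. intros t [Ht _]. lra. }
{ now exists x. }
assert (Hm : x <= m <= y).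
{ split. now apply Hub. apply Hlub. intros t [Ht _]. lra. }
destruct (Hloc m eps Hm Heps) as [d [Hd Hstr]].
assert (Hex : exists s, E s /\ m - d < s).
{ apply Classical_Prop.NNPP. intro Hno.
  assert (m <= m - d); [|lra].
  apply Hlub. intros s Es. apply Rnot_lt_le. intro. apply Hno. now exists s. }
destruct Hex as [s [Es Hs]].
pose proof (Hub s Es) as Hsm. destruct Es as [Hsx Es].
(* [r] lies in [E], so [m < r] would contradict the supremum; only the capped case [r = y]
   survives. *)
set (r := Rmin (m + d / 2) y).
assert (Hr : m <= r <= y /\ r < m + d /\ (r = y \/ m < r)).
{ unfold r, Rmin. destruct (Rle_dec (m + d / 2) y); lra. }
assert (Er : E r).
{ split. lra. specialize (Hstr s r ltac:(lra) ltac:(lra) ltac:(lra) ltac:(lra)). lra. }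
pose proof (Hub r Er).
destruct Hr as [_ [_ [Hr|Hr]]]; [|lra].
destruct Er as [_ Er]. rewrite Hr in Er. lra.
Qed.

Lemma is_derive_straddle (k : R -> R) (t l eps : R) :
  is_derive k t l -> l <= 0 -> 0 < eps ->
  exists d : R, 0 < d /\
    (forall r, t <= r < t + d -> k r - k t <= eps * (r - t)) /\
    (forall s, t - d < s <= t -> k t - k s <= eps * (t - s)).
Proof.
intros Hk Hl Heps.
apply is_derive_Reals in Hk.
destruct (Hk eps Heps) as [[d Hd] Hlim]; simpl in Hlim.
exists d; split; [exact Hd|].
assert (Hq : forall h, h <> 0 -> Rabs h < d -> (k (t + h) - k t) / h < eps).
{ intros h Hh0 Hh. specialize (Hlim h Hh0 Hh).
  apply Rabs_def2 in Hlim. lra. }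
split.
- intros r Hr. destruct (Req_dec r t) as [->|Hne]; [lra|].
  specialize (Hq (r - t) ltac:(lra) ltac:(rewrite Rabs_pos_eq; lra)).
  replace (t + (r - t)) with r in Hq by ring.
  apply (Rmult_lt_compat_r (r - t)) in Hq; [|lra].
  replace ((k r - k t) / (r - t) * (r - t)) with (k r - k t) in Hq by (field; lra). lra.
- intros s Hs. destruct (Req_dec s t) as [->|Hne]; [lra|].
  specialize (Hq (s - t) ltac:(lra) ltac:(rewrite Rabs_left; lra)).
  replace (t + (s - t)) with s in Hq by ring.
  apply (Rmult_lt_compat_r (t - s)) in Hq; [|lra].
  replace ((k s - k t) / (s - t) * (t - s)) with (k t - k s) in Hq by (field; lra). lra.
Qed.

(* A and B need not be differentiable: along the decreasing factors only the
   sign of their increments matters, so it suffices to control the increments of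
   u and v with A and B frozen at a point. *)
Lemma weighted_sum_decreasing (u v du dv A B : R -> R) (x y : R) :
  x <= y ->
  (forall t, x <= t <= y -> is_derive u t (du t)) ->
  (forall t, x <= t <= y -> is_derive v t (dv t)) ->
  (forall t, x <= t <= y -> 0 <= u t /\ 0 <= v t) ->
  decreasing_on (fun t => x <= t <= y) A ->
  decreasing_on (fun t => x <= t <= y) B ->
  (forall t, x <= t <= y -> du t * A t + dv t * B t <= 0) ->
  u y * A y + v y * B y <= u x * A x + v x * B x.
Proof.
intros Hxy Du Dv Hpos HA HB Hd.
apply (straddle_decreasing (fun t => u t * A t + v t * B t)); [exact Hxy|].
intros t eps Ht Heps.
set (k := fun z => u z * A t + v z * B t).
assert (Dk : is_derive k t (du t * A t + dv t * B t)).
{ unfold k. specialize (Du t Ht). specialize (Dv t Ht). auto_derive.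
  - repeat split; [now exists (du t) | now exists (dv t)].
  - rewrite (Derive_eta u t (du t)) by exact Du.
    rewrite (Derive_eta v t (dv t)) by exact Dv. ring. }
destruct (is_derive_straddle k t _ eps Dk (Hd t Ht) Heps) as [d [Hd0 [Hr Hs]]].
exists d; split; [exact Hd0|].
intros s r Hst Htr Hsd Hrd.
specialize (Hr r ltac:(lra)). specialize (Hs s ltac:(lra)). unfold k in Hr, Hs.
(* Freezing the factors at [t] raises the sum to the right of [t] and lowers it to the left, so the
   true increment is at most [k r - k s]. *)
assert (u r * A r <= u r * A t) by (apply Rmult_le_compat_l; [apply Hpos; lra | apply HA; lra]).
assert (v r * B r <= v r * B t) by (apply Rmult_le_compat_l; [apply Hpos; lra | apply HB; lra]).
assert (u s * A t <= u s * A s) by (apply Rmult_le_compat_l; [apply Hpos; lra | apply HA; lra]).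
assert (v s * B t <= v s * B s) by (apply Rmult_le_compat_l; [apply Hpos; lra | apply HB; lra]).
lra.
Qed.

(** * Derivative of an inverse and one-sided maxima *)

(** Continuity of [f] at [y] comes from strict monotonicity of [h], which traps [f v] between
    [f y - e] and [f y + e]. The difference quotient of [f] is then the inverse of one of [h], taken
    at the small increment [f (y + z) - f y]. *)
Lemma is_derive_inverse (D : R -> Prop) (h f : R -> R) (y d : R) :
  (forall s t, D s -> D t -> s < t -> h s < h t) ->
  locally (f y) D ->
  locally y (fun v => D (f v) /\ h (f v) = v) ->
  is_derive h (f y) d -> 0 < d ->
  is_derive f y (/ d).
Proof.
intros Hinc HD [e0 Hinv] Dh Hd.
assert (Hy : D (f y) /\ h (f y) = y) by apply Hinv, ball_center.
assert (Hcont : forall e, 0 < e -> exists e1, 0 < e1 /\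
  forall v, Rabs (v - y) < e1 -> Rabs (f v - f y) < e).
{ destruct HD as [e2 HD]. intros e He.
  set (e' := Rmin e (e2 / 2)).
  assert (He' : 0 < e' <= e /\ e' < e2).
  { pose proof (cond_pos e2). unfold e', Rmin. destruct (Rle_dec e (e2 / 2)); lra. }
  assert (D (f y - e')).
  { apply HD. change (Rabs (f y - e' - f y) < e2).
    rewrite Rabs_left; lra. }
  assert (D (f y + e')).
  { apply HD. change (Rabs (f y + e' - f y) < e2).
    rewrite Rabs_pos_eq; lra. }
  assert (h (f y - e') < y) by (rewrite <- (proj2 Hy) at 2; apply Hinc; tauto || lra).
  assert (y < h (f y + e')) by (rewrite <- (proj2 Hy) at 1; apply Hinc; tauto || lra).
  pose proof (cond_pos e0).
  exists (Rmin e0 (Rmin (y - h (f y - e')) (h (f y + e') - y))).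
  split.
  { repeat apply Rmin_glb_lt; lra. }
  intros v Hv.
  assert (Rabs (v - y) < e0) by (eapply Rlt_le_trans; [exact Hv | apply Rmin_l]).
  assert (Rabs (v - y) < y - h (f y - e')).
  { eapply Rlt_le_trans; [exact Hv | eapply Rle_trans; [apply Rmin_r | apply Rmin_l]]. }
  assert (Rabs (v - y) < h (f y + e') - y).
  { eapply Rlt_le_trans; [exact Hv | eapply Rle_trans; [apply Rmin_r | apply Rmin_r]]. }
  destruct (Hinv v) as [Dv Ev]; [assumption|].
  repeat match goal with H : Rabs (v - y) < _ |- _ => apply Rabs_def2 in H end.
  apply Rabs_def1; apply Rnot_le_lt; intro Hc.
  - assert (h (f y + e') <= h (f v)); [|lra].
    destruct (Req_dec (f y + e') (f v)) as [->|]; [lra|].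
    apply Rlt_le, Hinc; tauto || lra.
  - assert (h (f v) <= h (f y - e')); [|lra].
    destruct (Req_dec (f y - e') (f v)) as [->|]; [lra|].
    apply Rlt_le, Hinc; tauto || lra. }
apply is_derive_Reals. apply is_derive_Reals in Dh.
intros eps Heps.
assert (Cinv : continuity_pt Rinv d).
{ apply (continuity_pt_inv (fun z => z)); [apply continuity_pt_id | lra]. }
destruct (Cinv eps Heps) as [eta [Heta Hclose]].
destruct (Dh eta Heta) as [delta Hdelta].
destruct (Hcont delta (cond_pos delta)) as [e1 [He1 Hc]].
assert (Hrad : 0 < Rmin e1 e0) by (apply Rmin_glb_lt; [exact He1 | apply cond_pos]).
exists (mkposreal _ Hrad). simpl. intros z Hz0 Hz.
assert (Hz1 : Rabs z < e1) by (eapply Rlt_le_trans; [exact Hz | apply Rmin_l]).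
assert (Hz2 : Rabs z < e0) by (eapply Rlt_le_trans; [exact Hz | apply Rmin_r]).
destruct (Hinv (y + z)) as [Dv Ev].
{ change (Rabs (y + z - y) < e0). now replace (y + z - y) with z by ring. }
assert (Hne : f (y + z) - f y <> 0).
{ intro E. assert (E' : f (y + z) = f y) by lra. rewrite E' in Ev. lra. }
specialize (Hc (y + z)). replace (y + z - y) with z in Hc by ring.
specialize (Hdelta (f (y + z) - f y) Hne (Hc Hz1)).
replace (f y + (f (y + z) - f y)) with (f (y + z)) in Hdelta by ring.
rewrite Ev, (proj2 Hy) in Hdelta.
replace (y + z - y) with z in Hdelta by ring.
set (q := z / (f (y + z) - f y)) in *.
replace ((f (y + z) - f y) / z) with (/ q) by (unfold q; field; tauto).
(* [continuity_pt] speaks only of points distinct from [d], so [q = d] is treated apart. *)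
destruct (Req_dec q d) as [->|Hq].
{ unfold Rminus. now rewrite Rplus_opp_r, Rabs_R0. }
apply Hclose. split; [split; [exact I | now apply not_eq_sym] | exact Hdelta].
Qed.

(** Converts convexity and subgradient inequalities, known along a segment starting at 0, into
    inequalities between derivatives. *)
Lemma is_derive_right_max (k : R -> R) (l : R) :
  is_derive k 0 l -> (forall a, 0 < a < 1 -> k a <= k 0) -> l <= 0.
Proof.
intros Dk Hk. apply Rnot_lt_le. intro Hl.
apply is_derive_Reals in Dk.
destruct (Dk l Hl) as [d Hd].
pose proof (cond_pos d).
set (a := Rmin (d / 2) (1 / 2)).
assert (Ha : 0 < a < 1 /\ a < d).
{ unfold a, Rmin. destruct (Rle_dec (d / 2) (1 / 2)); lra. }
specialize (Hd a ltac:(lra) ltac:(rewrite Rabs_pos_eq; lra)).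
rewrite Rplus_0_l in Hd. apply Rabs_def2 in Hd.
assert (0 < (k a - k 0) / a) by lra.
specialize (Hk a ltac:(lra)).
assert ((k a - k 0) / a <= 0); [|lra].
apply Rmult_le_reg_r with a; [lra|].
replace ((k a - k 0) / a * a) with (k a - k 0) by (field; lra). lra.
Qed.

(** * Fenchel conjugation of an essentially smooth transformation *)

Section Conjugate.
Context (phi : R -> Rbar) (Hphi : transformation phi) (Hsm : essentially_smooth phi).

Lemma conjugate_ge (t u : R) :
  0 <= u -> Rbar_le (Rbar_minus (t * u) (phi u)) (conjugate phi t).
Proof.
intros Hu. unfold conjugate, Rbar_lub. destruct (Rbar_ex_lub _) as [l [Hub Hlub]]; simpl.
apply Hub. now exists u.
Qed.

Lemma conjugate_le (t : R) (M : Rbar) :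
  (forall u, 0 <= u -> Rbar_le (Rbar_minus (t * u) (phi u)) M) ->
  Rbar_le (conjugate phi t) M.
Proof.
intros HM. unfold conjugate, Rbar_lub. destruct (Rbar_ex_lub _) as [l [Hub Hlub]]; simpl.
apply Hlub. intros y [u [Hu ->]]. now apply HM.
Qed.

(** Superlinearity gives [t * u < phi u] beyond some [U]; below it, [phi >= 0] bounds
    [t * u - phi u] by [Rabs t * Rmax U 0]. The point [u = 1] bounds the conjugate from below. *)
Lemma conjugate_finite (t : R) : is_finite (conjugate phi t).
Proof.
destruct (transf_superlinear phi Hphi t) as [U HU].
assert (Hle : Rbar_le (conjugate phi t) (Rabs t * Rmax U 0)).
{ apply conjugate_le. intros u Hu.
  pose proof (transf_ge0 phi Hphi u Hu) as H0.
  destruct (Rle_lt_dec u (Rmax U 0)) as [Hs|Hb].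
  - destruct (phi u) as [p| |]; simpl in *; try tauto.
    assert (t * u <= Rabs t * Rmax U 0); [|lra].
    apply Rle_trans with (Rabs t * u).
    + apply Rmult_le_compat_r; [exact Hu | apply RRle_abs].
    + apply Rmult_le_compat_l; [apply Rabs_pos | exact Hs].
  - assert (U < u) by (eapply Rle_lt_trans; [apply Rmax_l | exact Hb]).
    assert (0 < u) by (eapply Rle_lt_trans; [apply Rmax_r | exact Hb]).
    specialize (HU u H).
    assert (0 <= Rabs t * Rmax U 0) by (apply Rmult_le_pos; [apply Rabs_pos | apply Rmax_r]).
    destruct (phi u) as [p| |]; simpl in *; try tauto.
    assert (t * u < p); [|lra].
    replace p with (p / u * u) by (field; lra).
    apply Rmult_lt_compat_r; assumption. }
pose proof (conjugate_ge t 1 Rle_0_1) as Hge.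
rewrite (transf_at1 phi Hphi) in Hge. simpl in Hge.
destruct (conjugate phi t); simpl in *; easy.
Qed.

Lemma rconjugate_ge (t u : R) :
  0 < u -> t * u - rval phi u <= rconjugate phi t.
Proof.
intros Hu. pose proof (conjugate_ge t u (Rlt_le _ _ Hu)) as H.
rewrite <- (esm_finite phi Hsm u Hu), <- (conjugate_finite t) in H. exact H.
Qed.

(** Convexity on the segment from [u] to [v] makes the gap [k] maximal at [a = 0], so its derivative
    there is at most 0. The right side stays in [Rbar] because [phi 0] may be infinite. *)
Lemma tangent_le (u v : R) :
  0 < u -> 0 <= v ->
  Rbar_le (rval phi u + Derive (rval phi) u * (v - u)) (phi v).
Proof.
intros Hu Hv.
pose proof (transf_ge0 phi Hphi v Hv) as H0.
destruct (phi v) as [p| |] eqn:Ev; simpl in H0; try easy. simpl.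
set (k := fun a => rval phi (a * v + (1 - a) * u) - a * (p - rval phi u)).
assert (Dk : is_derive k 0 (Derive (rval phi) u * (v - u) - (p - rval phi u))).
{ unfold k. pose proof (esm_derivable phi Hsm u Hu) as Dphi.
  auto_derive.
  - replace (0 * v + (1 + - 0) * u) with u by ring. exact Dphi.
  - replace (0 * v + (1 + - 0) * u) with u by ring.
    change (Derive (fun x => rval phi x) u) with (Derive (rval phi) u). ring. }
apply is_derive_right_max in Dk; [lra|].
intros a Ha. unfold k.
replace (0 * v + (1 - 0) * u) with u by ring.
pose proof (transf_convex phi Hphi v u a Hv (Rlt_le _ _ Hu) Ha) as Hc.
assert (0 < a * v + (1 - a) * u).
{ apply Rplus_le_lt_0_compat; [apply Rmult_le_pos | apply Rmult_lt_0_compat]; lra. }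
rewrite Ev, <- (esm_finite phi Hsm u Hu), <- (esm_finite phi Hsm (a * v + (1 - a) * u)) in Hc
  by assumption.
simpl in Hc. fold (rval phi u) (rval phi (a * v + (1 - a) * u)) in Hc. lra.
Qed.

(** By the tangent inequality, the supremum defining the conjugate at the slope of [phi] at [u] is
    attained at [u]. *)
Lemma rconjugate_at_Derive (u : R) :
  0 < u ->
  rconjugate phi (Derive (rval phi) u) = Derive (rval phi) u * u - rval phi u.
Proof.
intros Hu. apply Rle_antisym; [|now apply rconjugate_ge].
set (s := Derive (rval phi) u).
assert (H : Rbar_le (conjugate phi s) (s * u - rval phi u)).
{ apply conjugate_le. intros v Hv.
  pose proof (tangent_le u v Hu Hv) as Ht. fold s in Ht.
  destruct (phi v) as [p| |]; simpl in *; try easy. lra. }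
rewrite <- (conjugate_finite s) in H. exact H.
Qed.

(* Fenchel-Young: u is a subgradient of the conjugate at phi'(u). *)
Lemma Derive_rconjugate (u : R) :
  0 < u ->
  ex_derive (rconjugate phi) (Derive (rval phi) u) ->
  Derive (rconjugate phi) (Derive (rval phi) u) = u.
Proof.
intros Hu [l Dl].
set (s := Derive (rval phi) u) in *.
assert (Hsub : forall x, rconjugate phi s + u * (x - s) <= rconjugate phi x).
{ intro x. unfold s at 1. rewrite rconjugate_at_Derive by exact Hu. fold s.
  pose proof (rconjugate_ge x u Hu). lra. }
rewrite (is_derive_unique _ _ _ Dl).
apply Rle_antisym.
(* The subgradient inequality at [s - h] yields [l <= u]; at [s + h], below, it yields [u <= l]. *)
- set (k := fun h => - rconjugate phi (s + (- h)) - u * h).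
  assert (Dk : is_derive k 0 (l - u)).
  { unfold k. assert (E : s + - 0 = s) by ring. auto_derive.
    - rewrite E. now exists l.
    - rewrite E, (Derive_eta (rconjugate phi) s l) by exact Dl. ring. }
  apply is_derive_right_max in Dk; [lra|].
  intros a Ha. unfold k. specialize (Hsub (s + - a)).
  replace (s + - 0) with s by ring. lra.
- set (k := fun h => - rconjugate phi (s + h) + u * h).
  assert (Dk : is_derive k 0 (u - l)).
  { unfold k. assert (E : s + 0 = s) by ring. auto_derive.
    - rewrite E. now exists l.
    - rewrite E, (Derive_eta (rconjugate phi) s l) by exact Dl. ring. }
  apply is_derive_right_max in Dk; [lra|].
  intros a Ha. unfold k. specialize (Hsub (s + a)).
  replace (s + 0) with s by ring. lra.
Qed.

(** Used for the positivity of psi': if phi'(u) < t, then psi'(t) > psi'(phi'(u)) = u > 0. *)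
Lemma Derive_unbounded_below (t : R) :
  exists u : R, 0 < u /\ Derive (rval phi) u < t.
Proof.
destruct (esm_at0 phi Hsm (fun y => y < t)) as [d Hd].
{ exists t. easy. }
pose proof (cond_pos d).
exists (d / 2). split; [lra|]. apply Hd; [|lra].
change (Rabs (d / 2 - 0) < d). rewrite Rminus_0_r, Rabs_pos_eq; lra.
Qed.

End Conjugate.

Lemma increasing_of_pos_derivative (h dh : R -> R) (s t : R) :
  (forall x, is_derive h x (dh x)) -> (forall x, 0 < dh x) -> s < t -> h s < h t.
Proof.
intros Dh Hpos Hst.
destruct (MVT_gen h s t dh) as [c [_ E]].
- intros. apply Dh.
- intros x _. apply derivable_continuous_pt. exists (dh x). now apply is_derive_Reals.
- specialize (Hpos c). assert (0 < dh c * (t - s)) by (apply Rmult_lt_0_compat; lra). lra.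
Qed.

(** * Calculus of [g] = psi' and its inverse [f] = phi' *)

Section Response.
Context (g g1 g2 f : R -> R).
Context (Dg : forall t, is_derive g t (g1 t)).
Context (Dg1 : forall t, is_derive g1 t (g2 t)).
Context (g1_pos : forall t, 0 < g1 t).
Context (g_pos : forall t, 0 < g t).
Context (gf : forall u, 0 < u -> g (f u) = u).

Lemma g_lt (s t : R) : s < t -> g s < g t.
Proof. now apply (increasing_of_pos_derivative g g1). Qed.

Lemma g_le (s t : R) : s <= t -> g s <= g t.
Proof. intros [H| ->]; [apply Rlt_le, g_lt, H | apply Rle_refl]. Qed.

Lemma f_lt (s t : R) : 0 < s -> 0 < t -> s < t -> f s < f t.
Proof.
intros Hs Ht Hst. apply Rnot_le_lt. intro H. apply g_le in H.
rewrite !gf in H by assumption. lra.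
Qed.

(** Both sides have the same image under [g], which is injective. *)
Lemma f_g (t : R) : f (g t) = t.
Proof.
pose proof (gf (g t) (g_pos t)) as E.
apply Rle_antisym; apply Rnot_lt_le; intro H; apply g_lt in H; lra.
Qed.

Lemma is_derive_f (u : R) : 0 < u -> is_derive f u (/ g1 (f u)).
Proof.
intros Hu. apply is_derive_inverse with (D := fun _ => True) (h := g); auto.
- intros s t _ _. apply g_lt.
- apply filter_forall. easy.
- apply filter_imp with (fun v => 0 < v).
  + intros v Hv. split; [exact I | now apply gf].
  + now apply open_gt.
Qed.

Lemma Rratio_f (u : R) : 0 < u -> Rratio f u = - (g2 (f u) / g1 (f u)) / g1 (f u).
Proof.
intros Hu. unfold Rratio.
change (Derive_n f 2 u) with (Derive (Derive f) u).
assert (D1 : Derive f u = / g1 (f u)) by now apply is_derive_unique, is_derive_f.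
pose proof (g1_pos (f u)).
assert (D2 : is_derive (fun v => / g1 (f v)) u (- (g2 (f u) * / g1 (f u)) / g1 (f u) ^ 2)).
{ apply (is_derive_inv (fun v => g1 (f v)) u); [|lra].
  replace (g2 (f u) * / g1 (f u)) with (/ g1 (f u) * g2 (f u)) by ring.
  exact (is_derive_comp g1 f u _ _ (Dg1 (f u)) (is_derive_f u Hu)). }
assert (D3 : Derive (Derive f) u = - (g2 (f u) * / g1 (f u)) / g1 (f u) ^ 2).
{ rewrite <- (is_derive_unique _ _ _ D2). apply Derive_ext_loc.
  apply filter_imp with (fun v => 0 < v).
  - intros v Hv. now apply is_derive_unique, is_derive_f.
  - now apply open_gt. }
rewrite D1, D3. field. lra.
Qed.

Lemma Rratio_g (t : R) : Rratio g t = g2 t / g1 t.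
Proof.
unfold Rratio. change (Derive_n g 2 t) with (Derive (Derive g) t).
rewrite (Derive_ext (Derive g) g1) by (intro; now apply is_derive_unique).
now rewrite (is_derive_unique _ _ _ (Dg t)), (is_derive_unique _ _ _ (Dg1 t)).
Qed.

(** By [Rratio_f], it suffices that [rg / g1] decreases, where [rg = g2 / g1]. This is
    [weighted_sum_decreasing] with the single weight [/ g1]: with [rg] frozen, the derivative is
    [- rg ^ 2 / g1 <= 0]. *)
Lemma Rratio_f_increasing :
  decreasing_on (fun _ => True) (Rratio g) ->
  increasing_on (fun u => 0 < u) (Rratio f).
Proof.
intros Hdec x y Hx Hy Hxy. rewrite !Rratio_f by assumption.
assert (Hf : f x <= f y).
{ destruct Hxy as [H| ->]; [now apply Rlt_le, f_lt | apply Rle_refl]. }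
set (rg := fun t => g2 t / g1 t).
assert (Hrg : forall s t, s <= t -> rg t <= rg s).
{ intros s t Hst. unfold rg. rewrite <- !Rratio_g. now apply Hdec. }
pose proof (weighted_sum_decreasing (fun t => / g1 t) (fun _ => 0)
  (fun t => - g2 t / g1 t ^ 2) (fun _ => 0) rg (fun _ => 0) (f x) (f y) Hf) as H.
assert (H' : / g1 (f y) * rg (f y) + 0 * 0 <= / g1 (f x) * rg (f x) + 0 * 0).
{ apply H.
  - intros t _. pose proof (g1_pos t). apply is_derive_inv; [apply Dg1 | lra].
  - intros t _. apply @is_derive_const.
  - intros t _. split; [|lra]. apply Rlt_le, Rinv_0_lt_compat, g1_pos.
  - intros s t _ _ Hst. now apply Hrg.
  - intros s t _ _ _. lra.
  - intros t _. unfold rg. pose proof (g1_pos t).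
    replace (- g2 t / g1 t ^ 2 * (g2 t / g1 t) + 0 * 0)
      with (- ((g2 t / g1 t) ^ 2 * / g1 t)) by (field; lra).
    assert (0 <= (g2 t / g1 t) ^ 2 * / g1 t); [|lra].
    apply Rmult_le_pos; [apply pow2_ge_0 | apply Rlt_le, Rinv_0_lt_compat, g1_pos]. }
fold (rg (f x)) (rg (f y)). unfold Rdiv. lra.
Qed.

(* With a = w - ell and b = - ell this is da/dw. *)
Definition response_weight (gam a b : R) : R :=
  (1 - gam) * g1 b / (gam * g1 a + (1 - gam) * g1 b).

(** R_rho with [gam], [a] and [b] left free. It remains meaningful at the endpoints: it is R_g(a)
    for [gam = 0] and - R_g(b) for [gam = 1]. *)
Definition response_ratio (gam a b : R) : R :=
  response_weight gam a b ^ 2 * (g2 a / g1 a)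
  - (1 - response_weight gam a b) ^ 2 * (g2 b / g1 b).

Lemma weight_denominator_pos (gam a b : R) :
  0 <= gam <= 1 -> 0 < gam * g1 a + (1 - gam) * g1 b.
Proof.
intros Hgam. pose proof (g1_pos a). pose proof (g1_pos b).
destruct (Rle_lt_dec gam 0).
- replace gam with 0 by lra. lra.
- apply Rplus_lt_le_0_compat; [apply Rmult_lt_0_compat | apply Rmult_le_pos]; lra.
Qed.

(** * The balance equation defining ell: existence, uniqueness, stability *)

(** At [b = f 1] the second value of [g] is 1, at [b = f 1 - w] the first one is. The remaining
    values deviate from 1 in opposite directions, so the intermediate value theorem applies between
    these two points. *)
Lemma balance_solution (gam w : R) :
  0 < gam < 1 -> exists b, gam * g (w + b) + (1 - gam) * g b = 1.
Proof.
intros Hgam.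
set (F := fun b => gam * g (w + b) + (1 - gam) * g b).
assert (Hg1 : g (f 1) = 1) by (apply gf; lra).
assert (E1 : F (f 1) = 1 + gam * (g (w + f 1) - 1)) by (unfold F; rewrite Hg1; ring).
assert (E2 : F (f 1 - w) = 1 + (1 - gam) * (g (f 1 - w) - 1)).
{ unfold F. replace (w + (f 1 - w)) with (f 1) by ring. rewrite Hg1. ring. }
assert (Hb : Rmin (F (f 1)) (F (f 1 - w)) <= 1 <= Rmax (F (f 1)) (F (f 1 - w))).
{ assert (Hpm : forall c r, 0 < c -> (0 <= r -> 0 <= c * r) /\ (r <= 0 -> c * r <= 0)).
  { intros. split; intro; nra. }
  destruct (Hpm gam (g (w + f 1) - 1) ltac:(lra)).
  destruct (Hpm (1 - gam) (g (f 1 - w) - 1) ltac:(lra)).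
  destruct (Rle_dec 0 w).
  - assert (g (f 1) <= g (w + f 1)) by (apply g_le; lra).
    assert (g (f 1 - w) <= g (f 1)) by (apply g_le; lra).
    split; [apply Rle_trans with (F (f 1 - w)); [apply Rmin_r | lra]
           |apply Rle_trans with (F (f 1)); [lra | apply Rmax_l]].
  - assert (g (w + f 1) <= g (f 1)) by (apply g_le; lra).
    assert (g (f 1) <= g (f 1 - w)) by (apply g_le; lra).
    split; [apply Rle_trans with (F (f 1)); [apply Rmin_l | lra]
           |apply Rle_trans with (F (f 1 - w)); [lra | apply Rmax_r]]. }
destruct (IVT_gen F (f 1) (f 1 - w) 1) as [b [_ Eb]]; [|exact Hb|now exists b].
intro b. apply derivable_continuous_pt.
exists (gam * g1 (w + b) + (1 - gam) * g1 b). apply is_derive_Reals.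
unfold F. auto_derive.
- repeat split; [now exists (g1 (w + b)) | now exists (g1 b)].
- rewrite (Derive_eta g _ _ (Dg (w + b))).
  rewrite (Derive_eta g _ _ (Dg b)). ring.
Qed.

Lemma balance_lt (gam w b b' : R) :
  0 <= gam <= 1 -> b < b' ->
  gam * g (w + b) + (1 - gam) * g b < gam * g (w + b') + (1 - gam) * g b'.
Proof.
intros Hgam Hb.
assert (g b < g b') by (apply g_lt; lra).
assert (g (w + b) < g (w + b')) by (apply g_lt; lra).
destruct (Rle_lt_dec gam 0).
- replace gam with 0 by lra. lra.
- apply Rplus_lt_le_compat; [apply Rmult_lt_compat_l | apply Rmult_le_compat_l]; lra.
Qed.

(** At [b0 - eps] and [b0 + eps] the limiting balance lies strictly on either side of 1. The same
    eventually holds along the sequence, and monotonicity in [b] then traps [b n]. *)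
Lemma balance_solution_cv (gam w b : nat -> R) (gam0 w0 b0 : R) :
  (forall n, 0 <= gam n <= 1) -> 0 <= gam0 <= 1 ->
  is_lim_seq gam gam0 -> is_lim_seq w w0 ->
  (forall n, gam n * g (w n + b n) + (1 - gam n) * g (b n) = 1) ->
  gam0 * g (w0 + b0) + (1 - gam0) * g b0 = 1 ->
  is_lim_seq b b0.
Proof.
intros Hgam Hgam0 Lgam Lw Eb Eb0.
assert (L : forall c, is_lim_seq (fun n => gam n * g (w n + c) + (1 - gam n) * g c)
  (gam0 * g (w0 + c) + (1 - gam0) * g c)).
{ intro c. apply is_lim_seq_plus'; apply is_lim_seq_mult'.
  - exact Lgam.
  - apply is_lim_seq_continuous with (f := g).
    + apply derivable_continuous_pt. exists (g1 (w0 + c)). apply is_derive_Reals, Dg.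
    + apply is_lim_seq_plus'; [exact Lw | apply is_lim_seq_const].
  - apply is_lim_seq_minus'; [apply is_lim_seq_const | exact Lgam].
  - apply is_lim_seq_const. }
apply is_lim_seq_spec. intro eps. pose proof (cond_pos eps) as Heps.
pose proof (balance_lt gam0 w0 (b0 - eps) b0 Hgam0 ltac:(lra)) as H1.
pose proof (balance_lt gam0 w0 b0 (b0 + eps) Hgam0 ltac:(lra)) as H2.
rewrite Eb0 in H1, H2.
assert (E1 : eventually (fun n => gam n * g (w n + (b0 - eps)) + (1 - gam n) * g (b0 - eps) < 1)).
{ apply (L (b0 - eps) (fun y => y < 1)). now apply open_lt. }
assert (E2 : eventually (fun n => 1 < gam n * g (w n + (b0 + eps)) + (1 - gam n) * g (b0 + eps))).
{ apply (L (b0 + eps) (fun y => 1 < y)). now apply open_gt. }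
generalize (filter_and _ _ E1 E2). apply filter_imp. intros n [P1 P2].
specialize (Eb n). apply Rabs_def1; apply Rnot_le_lt; intro Hc.
- destruct (Req_dec (b n) (b0 + eps)) as [E|Hne]; [rewrite <- E in P2; lra|].
  pose proof (balance_lt (gam n) (w n) (b0 + eps) (b n) (Hgam n) ltac:(lra)). lra.
- destruct (Req_dec (b n) (b0 - eps)) as [E|Hne]; [rewrite <- E in P1; lra|].
  pose proof (balance_lt (gam n) (w n) (b n) (b0 - eps) (Hgam n) ltac:(lra)). lra.
Qed.

(** * Differentiation along the solution for fixed gamma *)

(* [b w] stands for - ell_gamma(w). *)
Section Fixed_gamma.
Context (gam : R) (Hgam : 0 < gam < 1) (b : R -> R).
Context (Eb : forall w, gam * g (w + b w) + (1 - gam) * g (b w) = 1).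

Let rho w := gam * g (w + b w).
Let p w := response_weight gam (w + b w) (b w).

(** If [b] rose, both terms of the balance would rise and the sum would exceed 1; with [b] falling,
    if [w + b w] also fell, the sum would drop below 1. *)
Lemma balance_monotone (w w' : R) : w <= w' -> b w' <= b w /\ w + b w <= w' + b w'.
Proof.
intros Hw. pose proof (Eb w) as E. pose proof (Eb w') as E'.
assert (Hb : b w' <= b w).
{ apply Rnot_lt_le. intro H.
  pose proof (balance_lt gam w (b w) (b w') ltac:(lra) H).
  assert (gam * g (w + b w') <= gam * g (w' + b w')); [|lra].
  apply Rmult_le_compat_l; [lra | apply g_le; lra]. }
split; [exact Hb|]. apply Rnot_lt_le. intro H.
assert (gam * g (w' + b w') < gam * g (w + b w)) by (apply Rmult_lt_compat_l; [lra | now apply g_lt]).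
assert ((1 - gam) * g (b w') <= (1 - gam) * g (b w)); [|lra].
apply Rmult_le_compat_l; [lra | now apply g_le].
Qed.

Lemma weight_bounds (w : R) : 0 <= p w <= 1.
Proof.
unfold p, response_weight.
pose proof (weight_denominator_pos gam (w + b w) (b w) ltac:(lra)) as Hd.
assert (0 < gam * g1 (w + b w)) by (apply Rmult_lt_0_compat; [lra | apply g1_pos]).
assert (0 < (1 - gam) * g1 (b w)) by (apply Rmult_lt_0_compat; [lra | apply g1_pos]).
split; [apply Rlt_le, Rdiv_lt_0_compat; lra | apply Rle_div_l; lra].
Qed.

(** Nothing is known yet about the derivative of [b], so [rho] is differentiated as the inverse of
    the explicit [h]: [f] recovers [w + b w] and [b w] from [rho w / gam] and
    [(1 - rho w) / (1 - gam)], and their difference is [w]. *)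
Lemma is_derive_response (w : R) : is_derive rho w (p w * (gam * g1 (w + b w))).
Proof.
pose proof (g1_pos (w + b w)) as Ha. pose proof (g1_pos (b w)) as Hb.
pose proof (weight_denominator_pos gam (w + b w) (b w) ltac:(lra)) as Hd.
set (h := fun r => f (r / gam) - f ((1 - r) / (1 - gam))).
assert (Harg : forall v, rho v / gam = g (v + b v) /\ (1 - rho v) / (1 - gam) = g (b v)).
{ intro v. unfold rho. split; [field; lra|].
  replace (1 - gam * g (v + b v)) with ((1 - gam) * g (b v)) by (pose proof (Eb v); lra).
  field. lra. }
assert (Hrho : forall v, 0 < rho v < 1).
{ intro v. assert (0 < gam * g (v + b v)) by (apply Rmult_lt_0_compat; [lra | apply g_pos]).
  assert (0 < (1 - gam) * g (b v)) by (apply Rmult_lt_0_compat; [lra | apply g_pos]).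
  specialize (Eb v). unfold rho. lra. }
(* The sum of the two inner reciprocals is the derivative of [h] at [rho w]. *)
replace (p w * (gam * g1 (w + b w)))
  with (/ (/ (gam * g1 (w + b w)) + / ((1 - gam) * g1 (b w))))
  by (unfold p, response_weight; field; repeat split; lra).
apply is_derive_inverse with (D := fun r => 0 < r < 1) (h := h).
- intros s t Hs Ht Hst. unfold h, Rdiv.
  assert (0 < / gam) by (apply Rinv_0_lt_compat; lra).
  assert (0 < / (1 - gam)) by (apply Rinv_0_lt_compat; lra).
  assert (f (s * / gam) < f (t * / gam)).
  { apply f_lt; try (apply Rmult_lt_0_compat; lra). apply Rmult_lt_compat_r; lra. }
  assert (f ((1 - t) * / (1 - gam)) < f ((1 - s) * / (1 - gam))).
  { apply f_lt; try (apply Rmult_lt_0_compat; lra). apply Rmult_lt_compat_r; lra. }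
  lra.
- apply (open_and (fun r => 0 < r) (fun r => r < 1)); [apply open_gt | apply open_lt | apply Hrho].
- apply filter_forall. intro v. split; [apply Hrho|].
  unfold h. destruct (Harg v) as [-> ->]. rewrite !f_g. ring.
- destruct (Harg w) as [Ea Ebw].
  pose proof (is_derive_f _ (g_pos (w + b w))) as Da. rewrite <- Ea in Da.
  pose proof (is_derive_f _ (g_pos (b w))) as Db. rewrite <- Ebw in Db.
  unfold h. auto_derive.
  + repeat split; [eexists; exact Da | eexists; exact Db].
  + change (1 + - rho w) with (1 - rho w). change (1 + - gam) with (1 - gam).
    change (rho w * / gam) with (rho w / gam).
    change ((1 - rho w) * / (1 - gam)) with ((1 - rho w) / (1 - gam)).
    rewrite (Derive_eta f _ _ Da), (Derive_eta f _ _ Db).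
    rewrite Ea, Ebw, !f_g. field. repeat split; lra.
- assert (0 < / (gam * g1 (w + b w))) by (apply Rinv_0_lt_compat, Rmult_lt_0_compat; lra).
  assert (0 < / ((1 - gam) * g1 (b w))) by (apply Rinv_0_lt_compat, Rmult_lt_0_compat; lra).
  lra.
Qed.

(** [b] inherits differentiability from [rho] through [b = f ((1 - rho) / (1 - gam))]. *)
Lemma is_derive_balance_solution (w : R) : is_derive b w (p w - 1).
Proof.
pose proof (g1_pos (w + b w)) as Ha. pose proof (g1_pos (b w)) as Hb.
pose proof (weight_denominator_pos gam (w + b w) (b w) ltac:(lra)) as Hd.
assert (Earg : forall v, (1 - rho v) / (1 - gam) = g (b v)).
{ intro v. unfold rho. replace (1 - gam * g (v + b v)) with ((1 - gam) * g (b v)) by (pose proof (Eb v); lra).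
  field. lra. }
apply is_derive_ext with (fun v => f ((1 - rho v) / (1 - gam))).
{ intro v. now rewrite Earg, f_g. }
pose proof (is_derive_response w) as Dr.
pose proof (is_derive_f _ (g_pos (b w))) as Df. rewrite <- Earg in Df.
auto_derive.
- repeat split; [eexists; exact Df | eexists; exact Dr].
- change (1 + - rho w) with (1 - rho w). change (1 + - gam) with (1 - gam).
  change ((1 - rho w) * / (1 - gam)) with ((1 - rho w) / (1 - gam)).
  rewrite (Derive_eta f _ _ Df), (Derive_eta rho _ _ Dr).
  rewrite Earg, f_g. unfold p, response_weight. field. repeat split; lra.
Qed.

Lemma is_derive_weight (w : R) :
  is_derive p w (- (p w * (1 - p w))
    * (p w * (g2 (w + b w) / g1 (w + b w)) + (1 - p w) * (g2 (b w) / g1 (b w)))).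
Proof.
pose proof (g1_pos (w + b w)) as Ha. pose proof (g1_pos (b w)) as Hb.
pose proof (weight_denominator_pos gam (w + b w) (b w) ltac:(lra)) as Hd.
pose proof (is_derive_balance_solution w) as Db.
unfold p at 1, response_weight at 1. auto_derive.
- repeat split; first [lra | eexists; eassumption | eexists; apply Dg1].
- rewrite (Derive_eta g1 _ _ (Dg1 (w + b w))).
  rewrite (Derive_eta g1 _ _ (Dg1 (b w))).
  rewrite (Derive_eta b _ _ Db).
  unfold p, response_weight. field. repeat split; lra.
Qed.

(** The logarithmic derivative of [rho' = p * gam * g1(a)] is [p' / p + p * R_g(a)]; inserting [p']
    leaves the two squared weights. *)
Lemma Rratio_response (w : R) : Rratio rho w = response_ratio gam (w + b w) (b w).
Proof.
pose proof (g1_pos (w + b w)) as Ha. pose proof (g1_pos (b w)) as Hb.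
pose proof (weight_denominator_pos gam (w + b w) (b w) ltac:(lra)) as Hd.
unfold Rratio. change (Derive_n rho 2 w) with (Derive (Derive rho) w).
rewrite (is_derive_unique _ _ _ (is_derive_response w)).
pose proof (is_derive_balance_solution w) as Db.
pose proof (is_derive_weight w) as Dp.
assert (D2 : is_derive (fun v => p v * (gam * g1 (v + b v))) w
  (- (p w * (1 - p w))
    * (p w * (g2 (w + b w) / g1 (w + b w)) + (1 - p w) * (g2 (b w) / g1 (b w)))
    * (gam * g1 (w + b w)) + p w * (gam * (p w * g2 (w + b w))))).
{ auto_derive.
  - repeat split; first [lra | eexists; eassumption | eexists; apply Dg1].
  - rewrite (Derive_eta g1 _ _ (Dg1 (w + b w))).
    rewrite (Derive_eta b _ _ Db).
    rewrite (Derive_eta p _ _ Dp). ring. }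
rewrite (eq_trans (Derive_ext (Derive rho) _ w
  (fun v => is_derive_unique _ _ _ (is_derive_response v))) (is_derive_unique _ _ _ D2)).
unfold response_ratio, p, response_weight. field. repeat split; lra.
Qed.

Lemma response_ratio_decreasing :
  decreasing_on (fun _ => True) (Rratio g) ->
  decreasing_on (fun _ => True) (Rratio rho).
Proof.
intros Hdec x y _ _ Hxy. rewrite !Rratio_response.
set (rg := fun t => g2 t / g1 t).
assert (Hrg : forall s t, s <= t -> rg t <= rg s).
{ intros s t Hst. unfold rg. rewrite <- !Rratio_g. now apply Hdec. }
(* The weighted mean of R_g for which [p' = - p (1 - p) m]. *)
set (m := fun t => p t * rg (t + b t) + (1 - p t) * rg (b t)).
pose proof (weighted_sum_decreasing (fun t => p t ^ 2) (fun t => (1 - p t) ^ 2)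
  (fun t => - (2 * p t * (p t * (1 - p t)) * m t))
  (fun t => 2 * (1 - p t) * (p t * (1 - p t)) * m t)
  (fun t => rg (t + b t)) (fun t => - rg (b t)) x y Hxy) as H.
unfold response_ratio. fold (p x) (p y) (rg (x + b x)) (rg (y + b y)) (rg (b x)) (rg (b y)).
enough (p y ^ 2 * rg (y + b y) + (1 - p y) ^ 2 * - rg (b y)
  <= p x ^ 2 * rg (x + b x) + (1 - p x) ^ 2 * - rg (b x)) by lra.
apply H.
- intros t _. pose proof (is_derive_weight t) as Dp. auto_derive.
  + eexists; exact Dp.
  + rewrite (Derive_eta p _ _ Dp). unfold m, rg. ring.
- intros t _. pose proof (is_derive_weight t) as Dp. auto_derive.
  + eexists; exact Dp.
  + rewrite (Derive_eta p _ _ Dp). unfold m, rg. ring.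
- intros t _. split; apply pow2_ge_0.
- intros s t _ _ Hst. apply Hrg. now apply balance_monotone.
- intros s t _ _ Hst. apply Ropp_le_contravar, Hrg. now apply balance_monotone.
- intros t _. pose proof (weight_bounds t) as Hp.
  assert (0 <= p t * (1 - p t) * m t ^ 2).
  { apply Rmult_le_pos; [apply Rmult_le_pos; lra | apply pow2_ge_0]. }
  (* The terms with frozen [rg] regroup into a second factor [m], which produces the square. *)
  replace (- (2 * p t * (p t * (1 - p t)) * m t) * rg (t + b t)
    + 2 * (1 - p t) * (p t * (1 - p t)) * m t * - rg (b t))
    with (- (2 * (p t * (1 - p t) * m t ^ 2))) by (unfold m; ring).
  lra.
Qed.

End Fixed_gamma.

(** * Limits as gamma tends to 0 or 1 *)

Context (g2_cont : forall t, continuous g2 t).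

Lemma response_ratio_cv (gam a b : nat -> R) (gam0 a0 b0 : R) :
  0 <= gam0 <= 1 ->
  is_lim_seq gam gam0 -> is_lim_seq a a0 -> is_lim_seq b b0 ->
  is_lim_seq (fun n => response_ratio (gam n) (a n) (b n)) (response_ratio gam0 a0 b0).
Proof.
intros Hgam Lgam La Lb.
assert (L1 : forall (x : nat -> R) (x0 : R), is_lim_seq x x0 -> is_lim_seq (fun n => g1 (x n)) (g1 x0)).
{ intros x x0. apply is_lim_seq_continuous with (f := g1).
  apply derivable_continuous_pt. exists (g2 x0). apply is_derive_Reals, Dg1. }
assert (Lr : forall (x : nat -> R) (x0 : R), is_lim_seq x x0 ->
  is_lim_seq (fun n => g2 (x n) / g1 (x n)) (g2 x0 / g1 x0)).
{ intros x x0 Lx. apply is_lim_seq_div'.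
  - apply is_lim_seq_continuous with (f := g2); [|exact Lx].
    apply continuity_pt_filterlim, g2_cont.
  - now apply L1.
  - apply Rgt_not_eq, g1_pos. }
assert (Lw : is_lim_seq (fun n => response_weight (gam n) (a n) (b n)) (response_weight gam0 a0 b0)).
{ assert (L1m : is_lim_seq (fun n => 1 - gam n) (1 - gam0))
    by (apply is_lim_seq_minus'; [apply is_lim_seq_const | exact Lgam]).
  apply is_lim_seq_div'.
  - apply is_lim_seq_mult'; auto.
  - apply is_lim_seq_plus'; apply is_lim_seq_mult'; auto.
  - apply Rgt_not_eq, weight_denominator_pos, Hgam. }
assert (Lsq : forall (x : nat -> R) (x0 : R), is_lim_seq x x0 -> is_lim_seq (fun n => x n ^ 2) (x0 ^ 2)).
{ intros x x0 Lx. simpl. repeat apply is_lim_seq_mult'; auto. apply is_lim_seq_const. }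
unfold response_ratio.
apply is_lim_seq_minus'; apply is_lim_seq_mult'; auto.
apply Lsq. apply is_lim_seq_minus'; [apply is_lim_seq_const | exact Lw].
Qed.

Context (b : R -> R -> R).
Context (Eb : forall gam w, 0 < gam < 1 ->
  gam * g (w + b gam w) + (1 - gam) * g (b gam w) = 1).
Context (Hdec : forall gam w w', 0 < gam < 1 -> 0 < w -> w <= w' ->
  response_ratio gam (w' + b gam w') (b gam w') <= response_ratio gam (w + b gam w) (b gam w)).

(** Extends the monotonicity to [gam0] = 0 or 1 and to [w = 0] by approximating with interior
    parameters and passing to the limit. *)
Lemma response_ratio_limit_decreasing (gam0 w w' b0 b0' : R) :
  0 <= gam0 <= 1 -> 0 <= w -> w <= w' ->
  gam0 * g (w + b0) + (1 - gam0) * g b0 = 1 ->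
  gam0 * g (w' + b0') + (1 - gam0) * g b0' = 1 ->
  response_ratio gam0 (w' + b0') b0' <= response_ratio gam0 (w + b0) b0.
Proof.
intros Hgam0 Hw Hww' E0 E0'.
set (e := fun n => / (INR n + 2)).
assert (He : forall n, 0 < e n <= / 2).
{ intro n. pose proof (pos_INR n). unfold e. split.
  - apply Rinv_0_lt_compat. lra.
  - apply Rinv_le_contravar; lra. }
assert (Le : is_lim_seq e 0).
{ apply (is_lim_seq_inv _ p_infty); [|easy].
  apply is_lim_seq_plus with p_infty 2; [apply is_lim_seq_INR | apply is_lim_seq_const | easy]. }
assert (Laff : forall x c : R, is_lim_seq (fun n => x + e n * c) x).
{ intros x c.
  replace (Finite x) with (Finite (x + 0 * c)) by (f_equal; ring).
  apply is_lim_seq_plus'; [apply is_lim_seq_const|].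
  apply is_lim_seq_mult'; [exact Le | apply is_lim_seq_const]. }
(* A convex combination of [gam0] and 1/2, hence strictly inside (0, 1); adding [e n] to [w]
   likewise makes it positive. *)
set (gam := fun n => gam0 + e n * (/ 2 - gam0)).
assert (Hgam : forall n, 0 < gam n < 1) by (intro n; specialize (He n); unfold gam; nra).
assert (L : forall x c, gam0 * g (x + c) + (1 - gam0) * g c = 1 ->
  is_lim_seq (fun n => response_ratio (gam n) (x + e n * 1 + b (gam n) (x + e n * 1))
    (b (gam n) (x + e n * 1))) (response_ratio gam0 (x + c) c)).
{ intros x c Ec.
  assert (Lb : is_lim_seq (fun n => b (gam n) (x + e n * 1)) c).
  { apply balance_solution_cv with gam (fun n => x + e n * 1) gam0 x; auto.
    - intro n. specialize (Hgam n). lra.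
    - apply Laff. }
  apply response_ratio_cv; auto; [apply Laff|].
  apply is_lim_seq_plus'; auto. }
refine (is_lim_seq_le _ _ _ _ _ (L w' b0' E0') (L w b0 E0)).
intro n. specialize (He n). apply Hdec; [apply Hgam | lra | lra].
Qed.

Lemma Rratio_g_decreasing : decreasing_on (fun _ => True) (Rratio g).
Proof.
intros x y _ _ Hxy. rewrite !Rratio_g.
assert (Hg : g (f 1) = 1) by (apply gf; lra).
assert (E0 : forall a c, response_ratio 0 a c = g2 a / g1 a).
{ intros a c. pose proof (g1_pos a). pose proof (g1_pos c).
  unfold response_ratio, response_weight. field. repeat split; lra. }
assert (E1 : forall a c, response_ratio 1 a c = - (g2 c / g1 c)).
{ intros a c. pose proof (g1_pos a). pose proof (g1_pos c).
  unfold response_ratio, response_weight. field. repeat split; lra. }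
(* At [gam = 0] the balance forces [b = f 1], so [a = w + f 1] sweeps the half-line from [f 1]. *)
assert (Right : forall s t, f 1 <= s -> s <= t -> g2 t / g1 t <= g2 s / g1 s).
{ intros s t Hs Hst.
  pose proof (response_ratio_limit_decreasing 0 (s - f 1) (t - f 1) (f 1) (f 1)) as H.
  rewrite !E0 in H. replace (t - f 1 + f 1) with t in H by ring.
  replace (s - f 1 + f 1) with s in H by ring.
  rewrite Hg in H. apply H; lra. }
(* At [gam = 1] it forces [a = f 1], so [b = f 1 - w]; the sign in - R_g(b) and the reversal of
   order cancel. *)
assert (Left : forall s t, t <= f 1 -> s <= t -> g2 t / g1 t <= g2 s / g1 s).
{ intros s t Ht Hst.
  pose proof (response_ratio_limit_decreasing 1 (f 1 - t) (f 1 - s) t s) as H.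
  rewrite !E1 in H. replace (f 1 - t + t) with (f 1) in H by ring.
  replace (f 1 - s + s) with (f 1) in H by ring.
  rewrite Hg in H. apply Ropp_le_cancel, H; lra. }
destruct (Rle_lt_dec (f 1) x); [now apply Right|].
destruct (Rle_lt_dec y (f 1)); [now apply Left|].
(* The halves are glued at [f 1], which both contain thanks to the limit [w = 0]. *)
apply Rle_trans with (g2 (f 1) / g1 (f 1)); [apply Right | apply Left]; lra.
Qed.

End Response.

Theorem proposition11 :
  forall phi : R -> Rbar,
    transformation phi ->
    essentially_smooth phi ->
    thrice_cont_diff (rconjugate phi) ->
    (forall t : R, 0 < Derive_n (rconjugate phi) 2 t) ->
    ((forall gamma : R, 0 < gamma < 1 ->
        strongly_S_shaped (response phi gamma))
     <-> decreasing_on (fun _ : R => True) (Rratio (Derive (rconjugate phi))))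
    /\ (decreasing_on (fun _ : R => True) (Rratio (Derive (rconjugate phi))) ->
        increasing_on (fun t : R => 0 < t) (Rratio (Derive (rval phi)))).
Proof.
intros phi Hphi Hsm Hdiff Hpos.
set (g := Derive (rconjugate phi)). set (f := Derive (rval phi)).
set (g1 := Derive_n (rconjugate phi) 2) in *. set (g2 := Derive_n (rconjugate phi) 3).
assert (Dg : forall t, is_derive g t (g1 t)).
{ intro t. apply Derive_correct, (proj1 (Hdiff t) 2%nat). lia. }
assert (Dg1 : forall t, is_derive g1 t (g2 t)).
{ intro t. apply Derive_correct, (proj1 (Hdiff t) 3%nat). lia. }
assert (g2_cont : forall t, continuous g2 t) by (intro t; apply Hdiff).
assert (gf : forall u, 0 < u -> g (f u) = u).
{ intros u Hu. apply Derive_rconjugate; auto. apply (proj1 (Hdiff _) 1%nat). lia. }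
assert (g_pos : forall t, 0 < g t).
{ intro t. destruct (Derive_unbounded_below phi Hsm t) as [u [Hu Hut]].
  apply Rlt_trans with (g (f u)); [now rewrite gf|].
  now apply (increasing_of_pos_derivative g g1). }
set (b := fun gam w => - ell phi gam w).
assert (Eb : forall gam w, 0 < gam < 1 ->
  gam * g (w + b gam w) + (1 - gam) * g (b gam w) = 1).
{ intros gam w Hgam.
  (* [iota] returns a solution once existence and uniqueness are shown; both are transferred from
     [c = - l]. *)
  apply (iota_correct (V := R_CompleteNormedModule)
    (fun l : R => gam * g (w - l) + (1 - gam) * g (- l) = 1)).
  destruct (balance_solution g g1 f Dg Hpos gf gam w Hgam) as [c Ec].
  exists (- c). split.
  - unfold Rminus. now rewrite Ropp_involutive.
  - intros l El. apply Ropp_eq_reg. rewrite Ropp_involutive.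
    destruct (Rtotal_order c (- l)) as [H|[H|H]]; [|exact H|];
      apply (balance_lt g g1 Dg Hpos gam w) in H; unfold Rminus in *; lra. }
assert (HR : forall gam w, 0 < gam < 1 -> Rratio (response phi gam) w
  = response_ratio g1 g2 gam (w + b gam w) (b gam w)).
(* [response phi gam] is convertible to the section's [rho], as [w - ell] unfolds to [w + - ell]. *)
{ intros gam w Hgam.
  apply (Rratio_response g g1 g2 f); auto. }
split; [split|].
- intros HS. apply (Rratio_g_decreasing g g1 g2 f Dg Dg1 Hpos gf g2_cont b Eb).
  intros gam w w' Hgam Hw Hww'. rewrite <- !HR by exact Hgam.
  apply HS; lra.
- intros Hdec gam Hgam x y _ _ Hxy.
  apply (response_ratio_decreasing g g1 g2 f Dg Dg1 Hpos g_pos gf gam Hgam (b gam)); auto.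
- apply (Rratio_f_increasing g g1 g2 f); auto.
Qed.
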